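(* Let $E=(E^0,E^1,\mathbf{r},\mathbf{s})$ be a directed graph, $G(E)$ its graph inverse semigroup, and $s,t\in G(E)$. Then $s\sim_s t$ if and only if exactly one of the following holds. (1) There exists a vertex $v\in E^0$ such that $\mathbf{r}^{-1}(v)=\{v\}$ and $s=v=t$. (2) There exist a loop $e\in E^1$ and $n_1,m_1,n_2,m_2\in\mathbb{N}$ such that $s=e^{n_1}e^{-m_1}$, $t=e^{n_2}e^{-m_2}$, $n_1-m_1=n_2-m_2$, and $\mathbf{r}^{-1}(\mathbf{s}(e))=\{\mathbf{s}(e),e\}$. (3) Neither $s$ nor $t$ is of the forms described in (1) and (2); that is, neither $s$ nor $t$ is a vertex $v$ with $\mathbf{r}^{-1}(v)=\{v\}$, and neither $s$ nor $t$ equals $e^{n}e^{-m}$ for some $n,m\in\mathbb{N}$ and some loop $e\in E^1$ with $\mathbf{r}^{-1}(\mathbf{s}(e))=\{\mathbf{s}(e),e\}$. (This case occurs if and only if $s\sim_s 0\sim_s t$.)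
   Context: $\mathbb{N}$ includes $0$. A directed graph $E=(E^0,E^1,\mathbf{r},\mathbf{s})$ consists of sets $E^0$ (vertices) and $E^1$ (edges), and functions $\mathbf{s},\mathbf{r}:E^1\to E^0$ (source and range). These are extended to $E^0$ by $\mathbf{s}(v)=v=\mathbf{r}(v)$ for $v\in E^0$; the preimage $\mathbf{r}^{-1}(v)$ is taken with respect to $\mathbf{r}:E^0\cup E^1\to E^0$ (so it always contains $v$). A loop is an edge $e$ with $\mathbf{s}(e)=\mathbf{r}(e)$. The graph inverse semigroup $G(E)$ is the semigroup with zero generated by $E^0$ and $E^1$ together with $E^{-1}=\{e^{-1}\mid e\in E^1\}$, subject to the relations, for all $v,w\in E^0$ and $e,f\in E^1$: $vw=\delta_{v,w}v$; $\mathbf{s}(e)e=e\mathbf{r}(e)=e$; $\mathbf{r}(e)e^{-1}=e^{-1}\mathbf{s}(e)=e^{-1}$; $e^{-1}f=\delta_{e,f}\mathbf{r}(e)$ (where $\delta$ is the Kronecker delta, and a coefficient $0$ means the zero of $G(E)$). For a loop $e$ and $n\in\mathbb{Z}$, $e^n$ denotes the product of $n$ copies of $e$ if $n>0$, the product of $|n|$ copies of $e^{-1}$ if $n<0$, and $\mathbf{s}(e)$ if $n=0$. For a semigroup $S$, $S^1$ denotes the monoid obtained by adjoining an identity element $1$ to $S$; if $S$ is already a monoid, $S^1=S$. For $s,t\in S$, $s\sim_s^1 t$ means there exist a positive integer $n$, elements $p_1,\dots,p_n\in S^1$, and a permutation $f$ of $\{1,\dots,n\}$ with $s=p_1\cdots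 p_n$ and $t=p_{f(1)}\cdots p_{f(n)}$; $\sim_s$ is the transitive closure of $\sim_s^1$. *)

(* Defs.v *)
From HB Require Import structures.
From mathcomp Require Import all_boot all_order all_algebra perm.
From mathcomp Require Import boolp classical_sets.
From Stdlib Require Import Relation_Operators.

Set Implicit Arguments.
Unset Strict Implicit.
Unset Printing Implicit Defensive.

Local Open Scope quotient_scope.

Record digraph := Digraph {
  vert : Type;
  edge : Type;
  src : edge -> vert;
  rng : edge -> vert }.

Definition is_loop (E : digraph) (e : edge E) : Prop := src e = rng e.

(* The range map extended to the disjoint union of vertices and edges. *)
Definition rng_ext (E : digraph) (x : vert E + edge E) : vert E :=
  match x with inl v => v | inr e => rng e end.

Definition rng_fiber (E : digraph) (v : vert E) : set (vert E + edge E) :=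
  (@rng_ext E @^-1` [set v])%classic.

(* The graph inverse semigroup is built from its presentation as a semigroup
   with zero: formal products of generators and 0, modulo the least congruence
   containing associativity, the zero laws and the defining relations. *)
Inductive gterm (E : digraph) : Type :=
| TZero
| TVert (v : vert E)
| TEdge (e : edge E)
| TInv (e : edge E)
| TMul (a b : gterm E).
Arguments TZero {E}.

Inductive gcong (E : digraph) : gterm E -> gterm E -> Prop :=
| gcong_refl a : gcong a a
| gcong_sym a b : gcong a b -> gcong b a
| gcong_trans a b c : gcong a b -> gcong b c -> gcong a c
| gcong_mul a a' b b' :
    gcong a a' -> gcong b b' -> gcong (TMul a b) (TMul a' b')
| gcong_assoc a b c : gcong (TMul a (TMul b c)) (TMul (TMul a b) c)
| gcong_0mul a : gcong (TMul TZero a) TZero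
| gcong_mul0 a : gcong (TMul a TZero) TZero
| gcong_vv v : gcong (TMul (TVert v) (TVert v)) (TVert v)
| gcong_vw v w : v <> w -> gcong (TMul (TVert v) (TVert w)) TZero
| gcong_src_edge e : gcong (TMul (TVert (src e)) (TEdge e)) (TEdge e)
| gcong_edge_rng e : gcong (TMul (TEdge e) (TVert (rng e))) (TEdge e)
| gcong_rng_inv e : gcong (TMul (TVert (rng e)) (TInv e)) (TInv e)
| gcong_inv_src e : gcong (TMul (TInv e) (TVert (src e))) (TInv e)
| gcong_inv_edge e : gcong (TMul (TInv e) (TEdge e)) (TVert (rng e))
| gcong_inv_edge0 e f : e <> f -> gcong (TMul (TInv e) (TEdge f)) TZero.

HB.instance Definition _ (E : digraph) := gen_eqMixin (gterm E).
HB.instance Definition _ (E : digraph) := gen_choiceMixin (gterm E).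

Section Quotient.
Variable E : digraph.

Definition gcongb : rel (gterm E) := fun a b => `[< gcong a b >].

Lemma gcongb_refl : reflexive gcongb.
Proof. by move=> a; apply/asboolP; apply: gcong_refl. Qed.

Lemma gcongb_sym : symmetric gcongb.
Proof. by move=> a b; apply/asboolP/asboolP; apply: gcong_sym. Qed.

Lemma gcongb_trans : transitive gcongb.
Proof.
move=> b a c /asboolP ab /asboolP bc.
by apply/asboolP; apply: gcong_trans ab bc.
Qed.

Canonical gcong_equiv := EquivRel gcongb gcongb_refl gcongb_sym gcongb_trans.

Definition gis := {eq_quot gcong_equiv}.
HB.instance Definition _ := Choice.on gis.
HB.instance Definition _ := EqQuotient.on gis.

Definition gis_mul : gis -> gis -> gis := lift_op2 gis (@TMul E).

Lemma gis_piP a b : \pi_gis a = \pi_gis b <-> gcong a b.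
Proof.
split; first by move/eqmodP/asboolP.
by move=> ab; apply/eqmodP/asboolP.
Qed.

Lemma gis_mul_pi a b : gis_mul (\pi_gis a) (\pi_gis b) = \pi_gis (TMul a b).
Proof.
rewrite /gis_mul -lock; apply/gis_piP.
by apply: gcong_mul; apply/gis_piP; rewrite reprK.
Qed.

Lemma gis_mulA : associative gis_mul.
Proof.
move=> x y z; rewrite -(reprK x) -(reprK y) -(reprK z) !gis_mul_pi.
by apply/gis_piP; apply: gcong_assoc.
Qed.

HB.instance Definition _ := isSemigroup.Build gis gis_mulA.

Definition gis0 : gis := \pi_gis TZero.
Definition gvert (v : vert E) : gis := \pi_gis (TVert v).
Definition gedge (e : edge E) : gis := \pi_gis (TEdge e).
Definition ginv (e : edge E) : gis := \pi_gis (TInv e).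

(* The power e^z, z an integer, with e^0 = s(e); only meaningful for loops. *)
Definition gpow (e : edge E) (z : int) : gis :=
  match z with
  | Posz n => iterop n *%g (gedge e) (gvert (src e))
  | Negz n => iterop n.+1 *%g (ginv e) (gvert (src e))
  end.

End Quotient.

Arguments gis0 {E}.

Section Conjugacy.
Variable S : semigroupType.

Definition has_identity : Prop :=
  exists u : S, forall x : S, (u * x = x /\ x * u = x)%g.

(* S^1 is modelled inside [option S], where [None] is the adjoined identity,
   which is available only when S is not already a monoid. *)
Definition in_S1 (x : option S) : Prop := x = None -> ~ has_identity.

Definition mulS1 (x y : option S) : option S :=
  match x, y with
  | None, _ => y
  | _, None => x
  | Some a, Some b => Some (a * b)%g
  end.

(* The unit [None] of an empty product disappears from a product over a
   nonempty range, so the two equations below really take place in S^1. *)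
Definition sim_s1 (s t : S) : Prop :=
  exists (n : nat) (p : 'I_n -> option S) (f : 'S_n),
    [/\ (0 < n)%N,
        forall i, in_S1 (p i),
        Some s = \big[mulS1/None]_(i < n) p i &
        Some t = \big[mulS1/None]_(i < n) p (f i)].

Definition sim_s : S -> S -> Prop := clos_trans S sim_s1.

End Conjugacy.

Section Forms.
Variable E : digraph.

Definition source_vertex (v : vert E) : Prop :=
  rng_fiber v = [set inl v]%classic.

Definition sole_loop (e : edge E) : Prop :=
  is_loop e /\ rng_fiber (src e) = [set inl (src e); inr e]%classic.

Definition vertex_form (x : gis E) : Prop :=
  exists v : vert E, source_vertex v /\ x = gvert v.

Definition loop_form (x : gis E) : Prop :=
  exists (e : edge E) (n m : nat),
    sole_loop e /\ x = (gpow e n%:Z * gpow e (- m%:Z)%R)%g.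

Definition case1 (s t : gis E) : Prop :=
  exists v : vert E, [/\ source_vertex v, s = gvert v & gvert v = t].

Definition case2 (s t : gis E) : Prop :=
  exists (e : edge E) (n1 m1 n2 m2 : nat),
    [/\ sole_loop e,
        s = (gpow e n1%:Z * gpow e (- m1%:Z)%R)%g,
        t = (gpow e n2%:Z * gpow e (- m2%:Z)%R)%g &
        (n1%:Z - m1%:Z = n2%:Z - m2%:Z)%R].

Definition case3 (s t : gis E) : Prop :=
  [/\ ~ vertex_form s, ~ vertex_form t, ~ loop_form s & ~ loop_form t].

End Forms.

Definition exactly_one (A B C : Prop) : Prop :=
  [\/ [/\ A, ~ B & ~ C], [/\ ~ A, B & ~ C] | [/\ ~ A, ~ B & C]].

(* Main.v *)
Require Import Defs.
From mathcomp Require Import all_boot all_order all_algebra perm.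
From mathcomp Require Import boolp classical_sets.
From Stdlib Require Import Relation_Operators.

(** Call a vertex v rigid when at most one edge ends at v and that edge, if it
    exists, is a loop. The rigid vertices are exactly the source vertices and
    the base points of the sole loops, so cases (1) and (2) are about them and
    case (3) is about everything else.

    _Invariance._ A rigid vertex v carries a character of G(E), a
    multiplicative map into the rationals: it sends v to 1, the edge ending at v
    to 2, the inverse of that edge to 1/2, and all other generators to 0. The
    relation e^-1 e = r(e) survives because r(e) = v forces e to be the loop at
    v, and e^-1 f = 0 survives because two different edges cannot both end at v.
    As the rationals commute under multiplication, a character does not see the
    order of the factors, hence is constant on the classes of sim_s
    ([sim_s_multiplicative], [sim_char]). By induction on words, the elements on
    which the character of v does not vanish are v alone if v is a source
    vertex ([char_source]) and the e^n e^-m if v carries the sole loop e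
    ([char_loop]); the value at e^n e^-m is 2^(n-m), from which n - m is
    recovered.

    _Transitivity within a class._ One exchange of adjacent factors turns
    e^n e^k e^-k e^-m into e^n e^-k e^k e^-m = e^n e^-m ([sim_loop]), which
    settles case (2).

    _Collapse to 0._ Call x collapsing when x = abcd with acbd = 0. The
    collapsing elements form an ideal, and every vertex that is not rigid is
    collapsing ([collapsing_vert]). If x and y have nonzero characters at
    distinct vertices v and w, then xy = xvwy = 0. So an induction on words,
    without any normal form, shows that every element either collapses or has a
    nonzero character at some rigid vertex ([collapsing_or_char]); the elements
    of the first kind are those of case (3). *)

Set Implicit Arguments.
Unset Strict Implicit.
Unset Printing Implicit Defensive.

Import GRing.Theory.

Local Open Scope quotient_scope.

(** * Rearranging factors in a semigroup *)

Section Rearrangement.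
Variable S : semigroupType.
Local Open Scope group_scope.

Lemma sim_s1_swap (a b c d : S) : sim_s1 (a * b * c * d) (a * c * b * d).
Proof.
pose i1 : 'I_4 := Ordinal (isT : 1 < 4)%N.
pose i2 : 'I_4 := Ordinal (isT : 2 < 4)%N.
exists 4, (fun i : 'I_4 => Some (nth a [:: a; b; c; d] i)), (tperm i1 i2).
split=> //; first by rewrite !big_ord_recl big_ord0 /= !mulgA.
by rewrite !big_ord_recl big_ord0 !permE /= !mulgA.
Qed.

Lemma sim_s_swap (s t a b c d : S) :
  s = a * b * c * d -> t = a * c * b * d -> sim_s s t.
Proof. by move=> -> ->; apply: t_step; apply: sim_s1_swap. Qed.

Lemma sim_s_refl (s : S) : sim_s s s.
Proof.
apply: t_step; exists 1%N, (fun=> Some s), 1%g.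
by split=> //; rewrite big_ord_recl big_ord0.
Qed.

(** A commutative target cannot see the order of the factors; the adjoined
    identity is sent to 1. *)
Lemma sim_s_multiplicative (R : comPzRingType) (chi : S -> R) (s t : S) :
  {morph chi : x y / (x * y)%g >-> (x * y)%R} -> sim_s s t -> chi s = chi t.
Proof.
move=> chiM; elim=> [x y|x y z _ -> _ -> //].
case=> n [p [f [_ _ Ex Ey]]].
pose chi1 (o : option S) : R := if o is Some a then chi a else 1%R.
have chi1M : {morph chi1 : u w / mulS1 u w >-> (u * w)%R}.
  by move=> [u|] [w|] /=; rewrite ?chiM ?mulr1 ?mul1r.
rewrite -[chi x]/(chi1 (Some x)) -[chi y]/(chi1 (Some y)) Ex Ey.
rewrite !(big_morph chi1 chi1M (erefl _)).
by rewrite (reindex_inj (@perm_inj _ f)).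
Qed.

End Rearrangement.

(** * Rigid vertices *)

Section GraphInverseSemigroup.
Variable E : digraph.
Implicit Types (v w : vert E) (e f : edge E) (x y s t : gis E) (a b : gterm E).

(** Taking f = g shows that even a single edge ending at v has to be a loop. *)
Definition rigid v : Prop :=
  forall f g, rng f = v -> rng g = v -> f = g /\ src f = v.

Lemma source_vertexP v : source_vertex v <-> forall f, rng f <> v.
Proof.
split=> [Ev f fv | noedge].
  have : rng_fiber v (inr f) by [].
  by rewrite Ev.
apply/seteqP; split=> [[w|f]|_ ->] //=; last by move/noedge.
by move=> <-.
Qed.

Lemma sole_loopP e :
  sole_loop e <-> src e = rng e /\ forall f, rng f = src e -> f = e.
Proof.
split=> [[le Ee]|[le only]].
  split=> // f fe; have : rng_fiber (src e) (inr f) by [].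
  by rewrite Ee => -[|[]].
split=> //; apply/seteqP.
split=> [[w <-|f /only ->]|_ [->|->]] /=; first by left.
- by right.
- by [].
- by rewrite /rng_fiber /= -le.
Qed.

Lemma rigidP v :
  rigid v <-> source_vertex v \/ exists2 e, sole_loop e & src e = v.
Proof.
split=> [rv|[/source_vertexP nov|[e /sole_loopP[_ only] <-]] f g].
- case: (pselect (exists f, rng f = v)) => [[f fv]|nov]; last first.
    by left; apply/source_vertexP=> f fv; apply: nov; exists f.
  have [_ sf] := rv f f fv fv; right; exists f => //.
  apply/sole_loopP; split=> [|g]; first by rewrite sf.
  by rewrite sf => gv; have [] := rv g f gv fv.
- by move/nov.
- by move=> /only -> /only ->.
Qed.

(** * The defining relations in the quotient *)

Local Open Scope group_scope.

Lemma pi_mul a b : \pi_(gis E) (TMul a b) = \pi_(gis E) a * \pi_(gis E) b.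
Proof. by rewrite -gis_mul_pi. Qed.

Lemma gis_ind (P : gis E -> Prop) :
  P gis0 -> (forall v, P (gvert v)) -> (forall e, P (gedge e)) ->
  (forall e, P (ginv e)) -> (forall x y, P x -> P y -> P (x * y)) ->
  forall x, P x.
Proof.
move=> P0 Pv Pe Pi PM x; rewrite -(reprK x).
elim: (repr x) => [|v|e|e|a Pa b Pb]; first exact: P0.
- exact: Pv.
- exact: Pe.
- exact: Pi.
- by rewrite pi_mul; apply: PM.
Qed.

Lemma mul0 x : gis0 * x = gis0.
Proof. by rewrite -(reprK x) -pi_mul; apply/gis_piP; constructor. Qed.

Lemma mulx0 x : x * gis0 = gis0.
Proof. by rewrite -(reprK x) -pi_mul; apply/gis_piP; constructor. Qed.

Lemma vert_idem v : gvert v * gvert v = gvert v.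
Proof. by rewrite -pi_mul; apply/gis_piP; constructor. Qed.

Lemma vert_orth v w : v <> w -> gvert v * gvert w = gis0.
Proof. by move=> vw; rewrite -pi_mul; apply/gis_piP; constructor. Qed.

Lemma src_edge e : gvert (src e) * gedge e = gedge e.
Proof. by rewrite -pi_mul; apply/gis_piP; constructor. Qed.

Lemma edge_rng e : gedge e * gvert (rng e) = gedge e.
Proof. by rewrite -pi_mul; apply/gis_piP; constructor. Qed.

Lemma rng_inv e : gvert (rng e) * ginv e = ginv e.
Proof. by rewrite -pi_mul; apply/gis_piP; constructor. Qed.

Lemma inv_src e : ginv e * gvert (src e) = ginv e.
Proof. by rewrite -pi_mul; apply/gis_piP; constructor. Qed.

Lemma inv_edge e : ginv e * gedge e = gvert (rng e).
Proof. by rewrite -pi_mul; apply/gis_piP; constructor. Qed.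

Lemma inv_edge_orth e f : e <> f -> ginv e * gedge f = gis0.
Proof. by move=> ef; rewrite -pi_mul; apply/gis_piP; constructor. Qed.

(** * The character of a rigid vertex *)

Fixpoint term_char v a : rat :=
  match a with
  | TZero => 0
  | TVert w => if `[< w = v >] then 1 else 0
  | TEdge f => if `[< rng f = v >] then 2 else 0
  | TInv f => if `[< rng f = v >] then 2^-1 else 0
  | TMul a b => term_char v a * term_char v b
  end%R.

(** Rigidity enters through the source and cancellation relations: if [f] ends
    at [v] then it also starts there, and no other edge ends at [v]. *)
Lemma term_char_gcong v a b :
  rigid v -> gcong a b -> term_char v a = term_char v b.
Proof.
move=> rv; elim=> {a b} //=.
- by move=> a b c _ -> _ ->.
- by move=> a a' b b' _ -> _ ->.
- by move=> a b c; rewrite mulrA.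
- by move=> a; rewrite mul0r.
- by move=> a; rewrite mulr0.
- by move=> w; case: asboolP => _; rewrite ?mulr1 ?mulr0.
- move=> u w uw; case: asboolP => [uv|_]; rewrite ?mul0r //.
  by case: asboolP => [wv|_]; rewrite ?mulr0 //; case: uw; rewrite uv wv.
- move=> f; case: (asboolP (rng f = v)) => [fv|_]; rewrite ?mulr0 //.
  by have [_ ->] := rv f f fv fv; rewrite asboolT // mul1r.
- by move=> f; case: asboolP => _; rewrite ?mulr1 ?mul0r.
- by move=> f; case: asboolP => _; rewrite ?mul1r ?mulr0.
- move=> f; case: (asboolP (rng f = v)) => [fv|_]; rewrite ?mul0r //.
  by have [_ ->] := rv f f fv fv; rewrite asboolT // mulr1.
- by move=> f; case: asboolP => _; rewrite ?mulr0 ?mulVf.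
- move=> f g fg; case: asboolP => [fv|_]; rewrite ?mul0r //.
  case: asboolP => [gv|_]; rewrite ?mulr0 //.
  by have [/fg] := rv f g fv gv.
Qed.

(** This is multiplicative, and independent of the representative, only when [v]
    is rigid. *)
Definition char v x : rat := term_char v (repr x).

Section Character.
Variable v : vert E.
Hypothesis rv : rigid v.

Lemma char_pi a : char v (\pi_(gis E) a) = term_char v a.
Proof. by apply: term_char_gcong => //; apply/gis_piP; rewrite reprK. Qed.

Lemma charM : {morph char v : x y / x * y >-> (x * y)%R}.
Proof.
by move=> x y; rewrite -(reprK x) -(reprK y) -pi_mul !char_pi.
Qed.

Lemma char0 : char v gis0 = 0%R. Proof. exact: char_pi. Qed.

Lemma char_vert w : char v (gvert w) = (if `[< w = v >] then 1 else 0)%R.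
Proof. exact: char_pi. Qed.

Lemma char_edge f : char v (gedge f) = (if `[< rng f = v >] then 2 else 0)%R.
Proof. exact: char_pi. Qed.

Lemma char_inv f : char v (ginv f) = (if `[< rng f = v >] then 2^-1 else 0)%R.
Proof. exact: char_pi. Qed.

(** A product has a nonzero character only if both factors do; hence the
    support is generated by the generators that lie in it. *)
Lemma char_ind (P : gis E -> Prop) :
  P (gvert v) -> (forall f, rng f = v -> P (gedge f) /\ P (ginv f)) ->
  (forall x y, P x -> P y -> P (x * y)) ->
  forall x, char v x <> 0%R -> P x.
Proof.
move=> Pv Pf PM; elim/gis_ind.
- by rewrite char0.
- by move=> w; rewrite char_vert; case: asboolP => [->|].
- by move=> f; rewrite char_edge; case: asboolP => [/Pf[]|].
- by move=> f; rewrite char_inv; case: asboolP => [/Pf[]|].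
- move=> x y Px Py; rewrite charM => /eqP; rewrite mulf_eq0 negb_or.
  by case/andP=> /eqP/Px ? /eqP/Py ?; apply: PM.
Qed.

(** Rigidity makes the support of the character sit in the local monoid
    v G(E) v. *)
Lemma char_local_unit x :
  char v x <> 0%R -> gvert v * x = x /\ x * gvert v = x.
Proof.
elim/char_ind=> [|f fv|{}x y [vx _] [_ yv]]; first by rewrite vert_idem.
  have [_ sv] := rv fv fv.
  have [ev ve] := (edge_rng f, src_edge f).
  have [vi iv] := (rng_inv f, inv_src f).
  by rewrite fv in ev vi; rewrite sv in ve iv.
by rewrite mulgA vx -mulgA yv.
Qed.

Lemma sim_char s t : sim_s s t -> char v s = char v t.
Proof. exact: sim_s_multiplicative charM. Qed.

End Character.

Lemma char_unique v w x :
  rigid v -> rigid w -> char v x <> 0%R -> char w x <> 0%R -> v = w.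
Proof.
move=> rv rw vx /(char_local_unit rw)[wx _]; move: vx.
by rewrite -wx charM // char_vert //; case: asboolP => [->|]; rewrite ?mul0r.
Qed.

(** * Elements that can be rearranged to zero *)

(** Asking for a single exchange of inner blocks, rather than for
    [sim_s x gis0], makes the ideal property immediate: multipliers are absorbed
    into the outer blocks [a] and [d]. *)
Definition collapsing x : Prop :=
  exists a b c d : gis E, x = a * b * c * d /\ a * c * b * d = gis0.

Lemma collapsing_sim x : collapsing x -> sim_s x gis0 /\ sim_s gis0 x.
Proof.
case=> a [b [c [d [xE E0]]]].
by split; [apply: sim_s_swap xE _|apply: sim_s_swap _ xE].
Qed.

Lemma collapsingMl x y : collapsing y -> collapsing (x * y).
Proof.
case=> a [b [c [d [-> E0]]]]; exists (x * a), b, c, d.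
by rewrite -(mulx0 x) -E0 !mulgA.
Qed.

Lemma collapsingMr x y : collapsing x -> collapsing (x * y).
Proof.
case=> a [b [c [d [-> E0]]]]; exists a, b, c, (d * y).
by rewrite !mulgA E0 mul0.
Qed.

Lemma collapsing0 : collapsing gis0.
Proof. by exists gis0, gis0, gis0, gis0; rewrite !mul0. Qed.

(** Let f and g witness that v is not rigid. If f = g, it is not a loop, and
    v = f^-1 f v rearranges to f^-1 v f, where f^-1 v = f^-1 s(f) v = 0. If f
    and g differ, v = (f^-1 f)(g^-1 g) rearranges to f^-1 g f g^-1 = 0. *)
Lemma collapsing_vert v : ~ rigid v -> collapsing (gvert v).
Proof.
move=> /existsNP[f /existsNP[g]].
move=> /not_implyP[fv /not_implyP[gv nfg]].
case: (pselect (f = g)) => [fg|neq].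
  have sv : src f <> v by move=> sv; apply: nfg.
  exists (ginv f), (gedge f), (gvert v), (gvert v).
  rewrite inv_edge fv !vert_idem; split=> //.
  by rewrite -(inv_src f) -(mulgA (ginv f)) (vert_orth sv) mulx0 !mul0.
exists (ginv f), (gedge f * ginv g), (gedge g), (gvert v).
split; last by rewrite (inv_edge_orth neq) !mul0.
by rewrite mulgA inv_edge -(mulgA _ (ginv g)) inv_edge fv gv !vert_idem.
Qed.

(** An edge or inverse edge absorbs the vertex at its range, so it collapses as
    soon as that vertex does. *)
Lemma collapsing_or_char x :
  collapsing x \/ exists2 v, rigid v & char v x <> 0%R.
Proof.
elim/gis_ind: x => [|v|f|f|x y].
- by left; apply: collapsing0.
- case: (pselect (rigid v)) => [rv|/collapsing_vert]; [right|by left].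
  by exists v => //; rewrite char_vert // asboolT.
- case: (pselect (rigid (rng f))) => [rv|nr]; [right|left].
    by exists (rng f) => //; rewrite char_edge // asboolT.
  by rewrite -edge_rng; apply: collapsingMl; apply: collapsing_vert.
- case: (pselect (rigid (rng f))) => [rv|nr]; [right|left].
    by exists (rng f) => //; rewrite char_inv // asboolT.
  by rewrite -rng_inv; apply: collapsingMr; apply: collapsing_vert.
- case=> [cx _|[v rv vx]]; first by left; apply: collapsingMr.
  case=> [cy|[w rw wy]]; first by left; apply: collapsingMl.
  case: (pselect (v = w)) => [vw|vw]; [right|left].
    exists v => //; rewrite charM //; apply/eqP.
    by rewrite mulf_neq0 //; apply/eqP; rewrite // vw.
  have [_ <-] := char_local_unit rv vx; have [<- _] := char_local_unit rw wy.
  rewrite mulgA -(mulgA x) (vert_orth vw) mulx0 mul0.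
  exact: collapsing0.
Qed.

(** * The support of the character *)

Lemma char_source v x : source_vertex v -> char v x <> 0%R -> x = gvert v.
Proof.
move=> sv; have rv : rigid v by apply/rigidP; left.
elim/(char_ind rv)=> // [f fv|{}x y -> ->]; last exact: vert_idem.
by move/source_vertexP: sv => /(_ f).
Qed.

Lemma char_source_vert v : source_vertex v -> char v (gvert v) <> 0%R.
Proof. by move=> sv; rewrite char_vert ?asboolT //; apply/rigidP; left. Qed.

Section Loop.
Variable e : edge E.
Hypothesis se : sole_loop e.
Let v := src e.

Let rv : rigid v. Proof. by apply/rigidP; right; exists e. Qed.
Let rng_e : rng e = v. Proof. by case: se. Qed.

Definition pos (n : nat) : gis E := gpow e n%:Z.
Definition neg (n : nat) : gis E := gpow e (- n%:Z)%R.

Lemma pos0 : pos 0 = gvert v. Proof. by []. Qed.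
Lemma neg0 : neg 0 = gvert v. Proof. by []. Qed.

Lemma posS n : pos n.+1 = gedge e * pos n.
Proof. by case: n => [|n] //; rewrite pos0 -rng_e edge_rng. Qed.

Lemma negS n : neg n.+1 = ginv e * neg n.
Proof. by case: n => [|n] //; rewrite neg0 /v inv_src. Qed.

Lemma vert_pos n : gvert v * pos n = pos n.
Proof. by case: n => [|n]; rewrite ?vert_idem // posS mulgA src_edge. Qed.

Lemma vert_neg n : gvert v * neg n = neg n.
Proof.
by case: n => [|n]; rewrite ?vert_idem // negS mulgA -rng_e rng_inv.
Qed.

Lemma posD m n : pos (m + n) = pos m * pos n.
Proof.
by elim: m => [|m IH]; rewrite ?vert_pos // addSn !posS IH mulgA.
Qed.

Lemma negD m n : neg (m + n) = neg m * neg n.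
Proof.
by elim: m => [|m IH]; rewrite ?vert_neg // addSn !negS IH mulgA.
Qed.

Lemma neg_pos n : neg n * pos n = gvert v.
Proof.
elim: n => [|n IH]; first exact: vert_idem.
rewrite -{1}addn1 negD posS -!mulgA (mulgA (neg 1)).
by rewrite [neg 1 * _]inv_edge rng_e vert_pos.
Qed.

Lemma neg_posM n k m : neg n * (pos (n + k) * neg m) = pos k * neg m.
Proof. by rewrite posD !mulgA neg_pos vert_pos. Qed.

Lemma pos_negM n k m : pos m * neg (k + n) * pos n = pos m * neg k.
Proof.
rewrite negD -!mulgA neg_pos; congr (_ * _).
by case: k => [|k]; rewrite ?vert_idem // -addn1 negD -mulgA [neg 1 * _]inv_src.
Qed.

(** The products e^n e^-m are closed under multiplication, as in the bicyclic
    monoid: an inner e^-m e^k cancels down to a power of e or of e^-1. *)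
Lemma char_loop x : char v x <> 0%R -> exists n m, x = pos n * neg m.
Proof.
elim/(char_ind rv)=> [|f fv|{}x y [n [m ->]] [k [l ->]]].
- by exists 0%N, 0%N; rewrite vert_idem.
- have -> : f = e by have [_] := (sole_loopP e).1 se; apply.
  split; [exists 1%N, 0%N | exists 0%N, 1%N]; last by rewrite vert_neg.
  by rewrite neg0 -rng_e [_ * _]edge_rng.
- have [mk|/ltnW km] := leqP m k.
    exists (n + (k - m)), l.
    by rewrite -mulgA -{1}(subnKC mk) neg_posM posD mulgA.
  exists n, (m - k + l).
  by rewrite mulgA -{1}(subnK km) pos_negM negD mulgA.
Qed.

Lemma char_pos_neg n m : char v (pos n * neg m) = (2 ^ (n%:Z - m%:Z))%R.
Proof.
rewrite charM //.
have -> : char v (pos n) = (2 ^+ n)%R.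
  elim: n => [|n IH]; first by rewrite char_vert // asboolT.
  by rewrite posS charM // char_edge // asboolT // IH exprS.
have -> : char v (neg m) = (2 ^- m)%R.
  elim: m => [|m IH]; first by rewrite char_vert // asboolT // invr1.
  by rewrite negS charM // char_inv // asboolT // IH exprS invfM.
by rewrite expfzDr // -exprnN.
Qed.

Lemma char_pos_neg_neq0 n m : char v (pos n * neg m) <> 0%R.
Proof. by rewrite char_pos_neg; apply/eqP; rewrite expfz_neq0. Qed.

Lemma loop_swap n m k :
  pos (n + k) * neg (k + m) = pos n * pos k * neg k * neg m /\
  pos n * neg m = pos n * neg k * pos k * neg m.
Proof.
rewrite posD negD !mulgA; split=> //.
by rewrite -(mulgA (pos n)) neg_pos -(mulgA (pos n)) vert_neg.
Qed.

(** Equal differences mean that one pair of exponents is obtained from the other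
    by adding a common k to both, which a single exchange of e^k and e^-k
    undoes. *)
Lemma sim_loop n1 m1 n2 m2 : (n1%:Z - m1%:Z = n2%:Z - m2%:Z)%R ->
  sim_s (pos n1 * neg m1) (pos n2 * neg m2).
Proof.
move=> /eqP; rewrite subr_eq addrAC eq_sym subr_eq -!PoszD => /eqP[] Enm.
have [le|/ltnW le] := leqP n1 n2.
  have [E1 E2] := loop_swap n1 m1 (n2 - n1).
  apply: sim_s_swap E2 _; rewrite -E1 subnKC //.
  congr (pos _ * neg _); apply: (@addnI n1).
  by rewrite addnA subnKC // -Enm addnC.
have [E1 E2] := loop_swap n2 m2 (n1 - n2).
apply: sim_s_swap _ E2; rewrite -E1 subnKC //.
congr (pos _ * neg _); apply: (@addnI n2).
by rewrite addnA subnKC // Enm addnC.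
Qed.

End Loop.

(** * The three cases in terms of characters *)

Lemma formP x :
  (vertex_form x \/ loop_form x) <-> exists2 v, rigid v & char v x <> 0%R.
Proof.
split=> [[[v [sv ->]]|[e [n [m [se ->]]]]]|[v rv vx]].
- by exists v; [apply/rigidP; left|apply: char_source_vert].
- by exists (src e); [apply/rigidP; right; exists e|apply: char_pos_neg_neq0].
- have [sv|[e se ev]] := (rigidP v).1 rv.
    by left; exists v; split=> //; apply: char_source.
  right; rewrite -ev in vx; have [n [m xE]] := char_loop se vx.
  by exists e, n, m.
Qed.

Lemma case3P s t :
  case3 s t <-> ~ (exists2 v, rigid v & char v s <> 0%R) /\
                ~ (exists2 v, rigid v & char v t <> 0%R).
Proof.
rewrite /case3; split.
  by case=> ? ? ? ?; split=> /formP[].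
by case=> Ns Nt; split=> F; [apply: Ns|apply: Nt|apply: Ns|apply: Nt];
  apply/formP; (by left) || by right.
Qed.

Lemma case3_sim0 s t : case3 s t <-> sim_s s gis0 /\ sim_s gis0 t.
Proof.
rewrite case3P; split=> [[Ns Nt]|[s0 t0]].
  have [/collapsing_sim[? _]|//] := collapsing_or_char s.
  by have [/collapsing_sim[_ ?]|//] := collapsing_or_char t.
split=> -[v rv]; first by rewrite (sim_char rv s0) char0.
by rewrite -(sim_char rv t0) char0.
Qed.

(** If v = e^n e^-m with v a source vertex, the characters of v and of s(e) are
    both nonzero there, so e would end at v. *)
Lemma case12_disjoint s t : case1 s t -> ~ case2 s t.
Proof.
case=> v [sv -> _] [e [n [m [_ [_ [se vE _ _]]]]]].
have ev : src e = v.
  apply: (@char_unique _ _ (gvert v)).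
  - by apply/rigidP; right; exists e.
  - by apply/rigidP; left.
  - by rewrite vE; apply: char_pos_neg_neq0.
  - exact: char_source_vert.
by case: se => le _; move/source_vertexP: sv => /(_ e); apply; rewrite -le.
Qed.

Lemma case13_disjoint s t : case1 s t -> ~ case3 s t.
Proof. by case=> v [sv -> _] [+ _ _ _]; apply; exists v. Qed.

Lemma case23_disjoint s t : case2 s t -> ~ case3 s t.
Proof.
by case=> e [n [m [_ [_ [se -> _ _]]]]] [_ _ + _]; apply; exists e, n, m.
Qed.

Lemma sim_s_cases s t : sim_s s t -> [\/ case1 s t, case2 s t | case3 s t].
Proof.
move=> st; case: (pselect (exists2 v, rigid v & char v s <> 0%R)); last first.
  move=> Ns; apply: Or33; apply/case3P; split=> // -[v rv].
  by rewrite -(sim_char rv st) => vs; apply: Ns; exists v.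
case=> v rv vs; have vst := sim_char rv st; have vt := vs; rewrite vst in vt.
have [sv|[e se ev]] := (rigidP v).1 rv.
  by apply: Or31; exists v; split=> //; [|symmetry]; apply: char_source.
apply: Or32; move: vs vt vst; rewrite -ev => vs vt.
have [n1 [m1 ->]] := char_loop se vs; have [n2 [m2 ->]] := char_loop se vt.
rewrite !char_pos_neg // => E2; exists e, n1, m1, n2, m2; split=> //.
(* Powers of 2 with integer exponents are distinct. *)
by apply: (@ieexprIz _ (2 : rat)%R) E2.
Qed.

End GraphInverseSemigroup.

(** * The classification *)

Theorem theorem29 (E : digraph) (s t : gis E) :
  (sim_s s t <-> exactly_one (case1 s t) (case2 s t) (case3 s t)) /\
  (case3 s t <-> sim_s s gis0 /\ sim_s gis0 t).
Proof.
split; last exact: case3_sim0; split=> [st|].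
  have d12 := @case12_disjoint _ s t; have d13 := @case13_disjoint _ s t.
  have d23 := @case23_disjoint _ s t.
  case: (sim_s_cases st) => H; [apply: Or31|apply: Or32|apply: Or33];
    split=> //.
  - exact: d12.
  - exact: d13.
  - by move/d12.
  - exact: d23.
  - by move/d13.
  - by move/d23.
case=> [[[v [_ -> <-]] _ _]|[_ [e [n1 [m1 [n2 [m2 [se -> -> Enm]]]]]] _]|[_ _]].
- exact: sim_s_refl.
- exact: sim_loop.
- by move=> /case3_sim0[s0 t0]; apply: t_trans s0 t0.
Qed.
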